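(* Let $T>0$, $\lambda>0$, $q\ge 0$, $n>1$, $w,w'>0$ be real constants, let $\omega\subseteq[0,1]$ be a nonempty compact set, and let $v$ be a (Lévy) measure on $(0,\infty)$ with $\int_0^\infty \min\{1,z\}\,v(\mathrm{d}z)<+\infty$. Let $\bar g\in\arg\min_{g\in\omega}\{(1-g)w+n^{-1}g^n w'\}$, and set $$\hat w=(1-\bar g)w+n^{-1}\bar g^{\,n}w',\qquad A_t=\frac{\hat w}{\lambda}\left(1-e^{\lambda(t-T)}\right),\quad 0\le t\le T .$$ Suppose that $(e^{A_t z}-1)\,v(\mathrm{d}z)$ is integrable on $(0,\infty)$ for every $t\in[0,T]$, and set $$B_t=\int_t^T\left(q\hat w+\int_0^\infty\left(e^{A_s z}-1\right)v(\mathrm{d}z)\right)\mathrm{d}s,\quad 0\le t\le T .$$ Then the function $$\Phi(t,x,y,u,m)=wxm+w'um-m\ln m+A_t\,my+B_t\,m$$ belongs to $C^1([0,T]\times(0,\infty)^4)$ and solves the Hamilton–Jacobi–Bellman–Isaacs equation $$\inf_{g\in\omega}\ \sup_{\theta:(0,\infty)\to(-1,+\infty)} L^{g,\theta}\Phi(t,x,y,u,m)=0,\qquad t\in[0,T),\ x,y,u,m>0,$$ with terminal condition $\Phi(T,x,y,u,m)=m(wx+w'u-\ln m)$ for $x,y,u,m>0$, where $$L^{g,\theta}\Phi=\frac{\partial \Phi}{\partial t}+(1-g)(y+q)\frac{\partial \Phi}{\partial x}+\frac{g^n}{n}(y+q)\frac{\partial \Phi}{\partial u}-\lambda y\frac{\partial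 \Phi}{\partial y}+\int_0^\infty\left(\Phi(t,x,y+z,u,m(1+\theta(z)))-\Phi(t,x,y,u,m)-\theta(z)\,m\frac{\partial \Phi}{\partial m}\right)v(\mathrm{d}z).$$
   Context: In the HJBI equation, the supremum is over measurable functions $\theta:(0,\infty)\to(-1,+\infty)$, the infimum is over scalars $g\in\omega$, and the partial derivatives without explicit argument are evaluated at $(t,x,y,u,m)$. The integral term is understood as an extended-real-valued integral. *)

(* Defs.v *)
From HB Require Import structures.
From mathcomp Require Import all_boot all_order all_algebra.
From mathcomp Require Import all_classical all_reals all_analysis.

Set Implicit Arguments.
Unset Strict Implicit.
Unset Printing Implicit Defensive.

Import Order.TTheory GRing.Theory Num.Theory.
Import numFieldNormedType.Exports.

Local Open Scope classical_set_scope.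
Local Open Scope ring_scope.

(* Derivative relative to I: the increments are restricted to those that stay
   in I, so it is one-sided at an endpoint of an interval. *)
Definition derivable_within (R : realType) (I : set R) (f : R -> R) (a : R)
    : Prop :=
  cvg ((fun h => h^-1 *: (f (h + a) - f a)) @ within [set h | I (h + a)] 0^').

Definition derive_within (R : realType) (I : set R) (f : R -> R) (a : R) : R :=
  lim ((fun h => h^-1 *: (f (h + a) - f a)) @ within [set h | I (h + a)] 0^').

Section Partials.
Context (R : realType) (T : R) (F : R -> R -> R -> R -> R -> R).

Definition partial_t (t x y u m : R) : R :=
  derive_within `[0, T] (fun s => F s x y u m) t.
Definition partial_x (t x y u m : R) : R := derive1 (fun s => F t s y u m) x.
Definition partial_y (t x y u m : R) : R := derive1 (fun s => F t x s u m) y.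
Definition partial_u (t x y u m : R) : R := derive1 (fun s => F t x y s m) u.
Definition partial_m (t x y u m : R) : R := derive1 (fun s => F t x y u s) m.

End Partials.

Definition uncurry5 (R : realType) (F : R -> R -> R -> R -> R -> R)
    (p : R * R * R * R * R) : R :=
  let: (t, x, y, u, m) := p in F t x y u m.

(* [0, T] * (0, +oo)^4 *)
Definition domain (R : realType) (T : R) : set (R * R * R * R * R) :=
  [set p | let: (t, x, y, u, m) := p in
    [/\ 0 <= t <= T, 0 < x, 0 < y, 0 < u & 0 < m]].

Definition C1_on_domain (R : realType) (T : R)
    (F : R -> R -> R -> R -> R -> R) : Prop :=
  [/\ {within domain T, continuous (uncurry5 F)},
      forall t x y u m : R, domain T (t, x, y, u, m) ->
        [/\ derivable_within `[0, T] (fun s => F s x y u m) t,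
            derivable (fun s => F t s y u m) x 1,
            derivable (fun s => F t x s u m) y 1,
            derivable (fun s => F t x y s m) u 1
          & derivable (fun s => F t x y u s) m 1]
    & [/\ {within domain T, continuous (uncurry5 (partial_t T F))},
          {within domain T, continuous (uncurry5 (partial_x F))},
          {within domain T, continuous (uncurry5 (partial_y F))},
          {within domain T, continuous (uncurry5 (partial_u F))}
        & {within domain T, continuous (uncurry5 (partial_m F))}]].

(* Measurable functions (0, +oo) -> (-1, +oo); values outside (0, +oo) are
   irrelevant. *)
Definition strategies (R : realType) : set (R -> R) :=
  [set theta : R -> R |
    measurable_fun (`]0, +oo[ : set (measurableTypeR R))
      (theta : measurableTypeR R -> measurableTypeR R) /\
    forall z, 0 < z -> -1 < theta z].

(* The measure v on (0, +oo) is given as a Borel measure on R of which only the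
   restriction to (0, +oo) is used. The integral is the difference of the
   integrals of the positive and negative parts, with value -oo when both are
   infinite. *)
Definition generator (R : realType) (T lambda q n : R)
    (v : {measure set (measurableTypeR R) -> \bar R})
    (F : R -> R -> R -> R -> R -> R) (g : R) (theta : R -> R)
    (t x y u m : R) : \bar R :=
  ((partial_t T F t x y u m
    + (1 - g) * (y + q) * partial_x F t x y u m
    + (g `^ n) / n * (y + q) * partial_u F t x y u m
    - lambda * y * partial_y F t x y u m)%R%:E
   + \int[v]_(z in `]0%R, +oo[)
       (F t x (y + z) u (m * (1 + theta z)) - F t x y u m
        - theta z * m * partial_m F t x y u m)%R%:E)%E.

Definition HJBI_operator (R : realType) (T lambda q n : R) (omega : set R)
    (v : {measure set (measurableTypeR R) -> \bar R})
    (F : R -> R -> R -> R -> R -> R) (t x y u m : R) : \bar R :=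
  ereal_inf [set ereal_sup [set generator T lambda q n v F g theta t x y u m
                           | theta in @strategies R]
            | g in omega].

Definition argmin (R : realType) (D : set R) (f : R -> R) : set R :=
  [set a | D a /\ forall b, D b -> f a <= f b].

Definition cost (R : realType) (n w w' g : R) : R :=
  (1 - g) * w + n^-1 * (g `^ n) * w'.

Definition coefA (R : realType) (T lambda what t : R) : R :=
  what / lambda * (1 - expR (lambda * (t - T))).

Definition coefB (R : realType) (T lambda q what : R)
    (v : {measure set (measurableTypeR R) -> \bar R}) (t : R) : R :=
  \int[lebesgue_measure]_(s in `[t, T])
    (q * what
     + \int[v]_(z in `]0, +oo[) (expR (coefA T lambda what s * z) - 1)).

Definition Phi (R : realType) (T lambda q w w' what : R)
    (v : {measure set (measurableTypeR R) -> \bar R}) (t x y u m : R) : R :=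
  w * x * m + w' * u * m - m * ln m + coefA T lambda what t * m * y
  + coefB T lambda q what v t * m.

(* Main.v *)
(* For this Phi the integrand of the generator at theta is
   m (s A_t z - s ln s + s - 1) with s = 1 + theta(z). By the convex duality
   s a - s ln s + s - 1 <= e^a - 1, with equality at s = e^a, the supremum over
   theta is attained at theta(z) = e^(A_t z) - 1, where the integral becomes
   m int (e^(A_t z) - 1) v(dz). Since A' = lambda A - what and
   B' = - q what - int (e^(A_t z) - 1) v(dz), what remains is
   m (y + q) (cost g - what), whose infimum over g is 0, attained at gbar. *)
Require Import Defs.
From HB Require Import structures.
From mathcomp Require Import all_boot all_order all_algebra.
From mathcomp Require Import all_classical all_reals all_analysis.
From mathcomp Require Import measurable_realfun ring lra.
Import Order.TTheory GRing.Theory Num.Theory.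
Import numFieldNormedType.Exports.
Local Open Scope classical_set_scope.
Local Open Scope ring_scope.

Set Implicit Arguments.
Unset Strict Implicit.

(** * Relative continuity and derivatives, monotonicity of integrals, elementary calculus *)

Lemma within_eq_continuous (X Y : topologicalType) (D : set X) (f g : X -> Y) :
  (forall p, D p -> f p = g p) -> (forall p, D p -> {for p, continuous g}) ->
  {within D, continuous f}.
Proof.
move=> fg gc; apply/subspace_continuousP => p Dp.
rewrite /from_subspace (fg p Dp).
apply: (@cvg_trans _ (g @ within D (nbhs p))).
  apply: near_eq_cvg; apply: filterS (withinT D _) => q Dq /=.
  by rewrite fg.
exact: cvg_within_filter (gc p Dp).
Qed.

(** Properness makes the limit in [derive_within] unique. It holds because a nondegenerate interval
    leaves room for a nonzero increment: to the right if [t < b], to the left if [t = b]. *)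
Lemma within_itv_dnbhs_proper (R : realType) (a b t : R) : a < b ->
  a <= t <= b ->
  ProperFilter (within [set h : R | `[a, b]%classic (h + t)] 0^').
Proof.
move=> ab /andP[at_ tb]; apply: Build_ProperFilter_ex => P.
rewrite /within /= => -[e /= e0 He].
have [tb'|] := ltP t b.
- pose h := Num.min (e / 2) (b - t).
  have h0 : 0 < h by rewrite lt_min; apply/andP; split; lra.
  have he : h <= e / 2 by rewrite ge_min lexx.
  have hb : h <= b - t by rewrite ge_min lexx orbT.
  exists h; apply: He => /=; last by rewrite in_itv/=; lra.
    by rewrite sub0r normrN gtr0_norm//; lra.
  by rewrite gt_eqF.
- move=> bt.
  pose h := Num.min (e / 2) (t - a).
  have h0 : 0 < h by rewrite lt_min; apply/andP; split; lra.
  have he : h <= e / 2 by rewrite ge_min lexx.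
  have hb : h <= t - a by rewrite ge_min lexx orbT.
  exists (- h); apply: He => /=; last by rewrite in_itv/=; lra.
    by rewrite sub0r normrN normrN gtr0_norm//; lra.
  by rewrite oppr_eq0 gt_eqF.
Qed.

(** Reduces one-sided differentiation at an endpoint to ordinary differentiation of an extension [g]
    of [f]: the relative difference quotients coincide, and restricting the filter keeps the
    limit. *)
Lemma derive_within_itv (R : realType) (a b t d : R) (f g : R -> R) : a < b ->
  a <= t <= b -> {in `[a, b], f =1 g} -> is_derive t 1 g d ->
  derivable_within `[a, b] f t /\ derive_within `[a, b] f t = d.
Proof.
move=> ab tab fg [dg gd].
have PF := within_itv_dnbhs_proper ab tab.
suff fd : (fun h => h^-1 *: (f (h + t) - f t)) @
    within [set h | `[a, b]%classic (h + t)] 0^' --> d.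
  by split; [apply/cvg_ex; exists d|exact: cvg_lim].
have : (fun h => h^-1 *: (g (h *: 1 + t) - g t)) @
    within [set h | `[a, b]%classic (h + t)] 0^' --> d.
  by apply: cvg_within_filter; rewrite -gd; exact: dg.
apply: cvg_trans.
apply: near_eq_cvg; apply: filterS (withinT _ _) => h /= hI.
by rewrite !fg ?in_itv//= [h *: 1]mulr1.
Qed.

(** No integrability is assumed, since an arbitrary strategy may give an infinite integral. Positive
    parts increase and negative parts decrease from [f] to [g]; the convention that [+oo - +oo] is
    [-oo] keeps the difference monotone. *)
Lemma le_integral_measurable d (T : measurableType d) (R : realType)
    (mu : {measure set T -> \bar R}) (D : set T) (f g : T -> \bar R) :
  measurable D -> measurable_fun D f -> measurable_fun D g ->
  (forall x, D x -> f x <= g x)%E ->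
  (\int[mu]_(x in D) f x <= \int[mu]_(x in D) g x)%E.
Proof.
move=> mD mf mg fg; rewrite integralE [leRHS]integralE leeB//.
- apply: ge0_le_integral => //; try exact: measurable_funepos.
  by move=> x Dx; apply: (@funepos_le _ _ D f g);
    [move=> y; rewrite inE; exact: fg|rewrite inE].
- apply: ge0_le_integral => //; try exact: measurable_funeneg.
  by move=> x Dx; apply: (@funeneg_le _ _ D f g);
    [move=> y; rewrite inE; exact: fg|rewrite inE].
Qed.

(* [1 + x <= expR x] at [x = a - ln s], multiplied by [s]; equality holds at
   [s = expR a]. *)
Lemma entropy_le (R : realType) (a s : R) : 0 < s ->
  s * a - s * ln s + s <= expR a.
Proof.
move=> s0; rewrite -[in leRHS](subrK (ln s) a) expRD lnK//.
have := expR_ge1Dx (a - ln s); nra.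
Qed.

Lemma is_derive_affine (R : realType) (k c x : R) :
  is_derive x 1 (fun s => k * s + c) k.
Proof.
have -> : (fun s => k * s + c) = k \*: id + cst c by [].
by apply: is_derive_eq; rewrite addr0 scaler1.
Qed.

Lemma is_derive_affine_entropy (R : realType) (k x : R) : 0 < x ->
  is_derive x 1 (fun s => k * s - s * ln s) (k - ln x - 1).
Proof.
move=> x0.
have -> : (fun s => k * s - s * ln s) = k \*: id - id * (@ln R) by [].
have := is_derive1_ln x0 => dln.
apply: is_derive_eq; rewrite /= !scaler1 [_ *: _]divff ?gt_eqF//; ring.
Qed.

Lemma is_derive_lincomb (R : realType) (f g : R -> R) (df dg c k l t : R) :
  is_derive t 1 f df -> is_derive t 1 g dg ->
  is_derive t 1 (fun s => c + f s * k + g s * l) (df * k + dg * l).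
Proof.
move=> dF dG.
have -> : (fun s => c + f s * k + g s * l) = cst c + k \*: f + l \*: g.
  by apply/funext => s; rewrite !fctE /= [_ *: f s]mulrC [_ *: g s]mulrC.
by apply: is_derive_eq; rewrite add0r [_ *: df]mulrC [_ *: dg]mulrC.
Qed.

Lemma continuous_fst_comp (X Y Z : topologicalType) (f : X -> Z) (p : X * Y) :
  {for p.1, continuous f} -> {for p, continuous (fun p => f p.1)}.
Proof. by move=> fp; apply: (cvg_comp fst f _ fp); exact: cvg_fst. Qed.

(** * The coefficients A and B and the jump integral *)

Section coefficients.
Context (R : realType) (T lambda q what : R).
Context (v : {measure set (measurableTypeR R) -> \bar R}).
Context (T_gt0 : 0 < T) (lambda_gt0 : 0 < lambda) (what_ge0 : 0 <= what).
Context (intA : forall t : R, 0 <= t <= T ->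
  v.-integrable `]0, +oo[
    (fun z => (expR (coefA T lambda what t * z) - 1)%:E)).

Let A := coefA T lambda what.

Lemma is_derive_coefA (t : R) :
  is_derive t 1 A (- what * expR (lambda * (t - T))).
Proof.
pose l (s : R) : R := lambda * s + - (lambda * T).
pose k (s : R) : R := - (what / lambda) * s + what / lambda.
have -> : A = k \o (expR \o l).
  by apply/funext => s; rewrite /A /coefA /k /l /= (mulrBr lambda); ring.
have dl : is_derive t 1 l lambda by exact: is_derive_affine.
have dk : is_derive (expR (l t)) 1 k (- (what / lambda)).
  exact: is_derive_affine.
have de := is_derive1_comp (is_derive_expR (l t)) dl.
have := @is_derive1_comp _ k (expR \o l) t _ _ dk de; congr (is_derive t 1 _ _).
rewrite /l mulrBr; field.
by rewrite gt_eqF.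
Qed.

Lemma continuous_coefA : continuous A.
Proof.
move=> t; apply: differentiable_continuous; apply/derivable1_diffP.
by have [] := is_derive_coefA t.
Qed.

(** Monotonicity of the exponential, with [what >= 0]. The bound by [A 0] provides a dominating
    function uniform in time. *)
Lemma coefA_bound (t : R) : 0 <= t <= T -> 0 <= A t <= A 0.
Proof.
move=> /andP[t0 tT]; have wl : 0 <= what / lambda by rewrite divr_ge0// ltW.
rewrite /A /coefA mulr_ge0//=.
  rewrite ler_wpM2l// lerB// ler_expR ler_pM2l//; lra.
by rewrite subr_ge0 -expR0 ler_expR pmulr_rle0// subr_le0.
Qed.

(* Freezing the time outside [0, T] makes the jump integral continuous on the
   whole line, so that the two-sided fundamental theorem of calculus applies at
   the endpoints. *)
Definition clamp (s : R) : R := Num.max 0 (Num.min s T).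

Lemma clamp_itv (s : R) : 0 <= clamp s <= T.
Proof.
by rewrite /clamp le_max lexx/= ge_max ltW//= ge_min lexx orbT.
Qed.

Lemma clampE (s : R) : 0 <= s <= T -> clamp s = s.
Proof. by move=> /andP[s0 sT]; rewrite /clamp min_l// max_r. Qed.

Lemma continuous_clamp : continuous clamp.
Proof.
move=> s; apply: (@continuous_max R _ (cst 0) (Num.min^~ T)).
  exact: cst_continuous.
apply: (@continuous_min R _ id (cst T)); first exact: cvg_id.
exact: cst_continuous.
Qed.

Definition jump (s : R) : R :=
  \int[v]_(z in `]0, +oo[) (expR (A (clamp s) * z) - 1).

(** Dominated convergence: for [z > 0] every integrand lies between 0 and [expR (A 0 * z) - 1],
    which is integrable by [intA] at time 0. *)
Lemma continuous_jump : continuous jump.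
Proof.
(* The radius 1 is arbitrary: [clamp] keeps all times in [0, T], so the domination is global. *)
move=> s; have s1 : s \in `]s - 1, s + 1[%classic.
  by rewrite inE /= in_itv /=; apply/andP; split; lra.
have := @continuity_under_integral R _ (measurableTypeR R) v
  (fun x z => expR (A (clamp x) * z) - 1) `]0, +oo[%classic (measurable_itv _)
  (s - 1) (s + 1) _ _ (fun z => expR (A 0 * z) - 1) _ _ s s1.
apply.
- by move=> x _; exact: intA (clamp_itv x).
- apply/aeW => z _ x _.
  apply: cvgB; last exact: cvg_cst.
  apply: continuous_comp; last exact: continuous_expR.
  apply: cvgM; last exact: cvg_cst.
  by apply: continuous_comp; [exact: continuous_clamp|exact: continuous_coefA].
- by apply: intA; rewrite lexx ltW.
- move=> x _; apply/aeW => z /=; rewrite in_itv/= andbT => z0.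
  have /andP[A0 A1] := coefA_bound (clamp_itv x).
  have Az : 0 <= A (clamp x) * z by apply: mulr_ge0 A0 (ltW z0).
  rewrite ger0_norm; last by rewrite subr_ge0 -[leLHS]expR0 ler_expR.
  by rewrite lerB// ler_expR ler_pM2r.
Qed.

Let h (s : R) : R := q * what + jump s.

Let continuous_h : continuous h.
Proof.
move=> s; have js := @continuous_jump s; rewrite /continuous_at in js *.
by apply: cvgD js; exact: cvg_cst.
Qed.

Let integrable_h (a b : R) :
  lebesgue_measure.-integrable `[a, b] (EFin \o h).
Proof.
apply: continuous_compact_integrable; first exact: segment_compact.
exact: continuous_subspaceT.
Qed.

(** An extension of B to times around [0, T], with [t] only in an upper limit of integration. The
    base point -1 puts [t = 0] strictly inside the interval of integration. *)
Definition coefB_ext (t : R) : R :=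
  \int[lebesgue_measure]_(s in `[-1, T]) h s
  - \int[lebesgue_measure]_(s in `[-1, t]) h s.

Lemma coefB_extE (t : R) : 0 <= t <= T ->
  Defs.coefB T lambda q what v t = coefB_ext t.
Proof.
move=> /andP[t0 tT]; rewrite /coefB_ext.
have t1 : -1 <= t by lra.
rewrite (@Rintegral_itvB R h (BLeft (-1)) (BRight T) t (@integrable_h _ _) t1
  tT).
(* The subtraction leaves the interval open at [t]; a single point has Lebesgue measure 0. *)
rewrite (@Rintegral_itv_obnd_cbnd R t (BRight T) h).
  apply: eq_Rintegral => s; rewrite inE/= in_itv/= => /andP[ts sT].
  by rewrite /h /jump clampE// (le_trans t0 ts).
apply: integrableS (@integrable_h t T) => //.
by apply: subset_itvr; rewrite bnd_simp.
Qed.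

Lemma is_derive_coefB_ext (t : R) : 0 <= t <= T ->
  is_derive t 1 coefB_ext (- (q * what + jump t)).
Proof.
move=> /andP[t0 tT].
(* The right end [T + 1] makes [t = T] an interior point as well. *)
have [dF F'] := @continuous_FTC1_closed R h (-1) t (T + 1) ltac:(lra)
  (@integrable_h _ _) ltac:(lra) (@continuous_h t).
have dF' : is_derive t 1
    (fun x => \int[lebesgue_measure]_(s in `[-1, x]) h s) (h t).
  by split; [exact: dF|rewrite -derive1E; exact: F'].
rewrite -[- _]sub0r; apply: is_deriveB.
Qed.

(** * Partial derivatives of Phi and its C1 regularity *)

Context (w w' : R).

Let B := coefB_ext.
Let F := Phi T lambda q w w' what v.

Lemma continuous_coefB_ext (t : R) : 0 <= t <= T -> {for t, continuous B}.
Proof.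
move=> tT; apply: differentiable_continuous; apply/derivable1_diffP.
by have [] := is_derive_coefB_ext tT.
Qed.

Lemma is_derive_Phi_t (t x y u m : R) : 0 <= t <= T ->
  let d := - what * expR (lambda * (t - T)) * (m * y)
           - (q * what + jump t) * m in
  derivable_within `[0, T] (fun s => F s x y u m) t /\
  partial_t T F t x y u m = d.
Proof.
move=> tT d; rewrite /partial_t.
pose c := w * x * m + w' * u * m - m * ln m.
have FE : {in `[0, T], (fun s => F s x y u m) =1
    (fun s => c + A s * (m * y) + B s * m)}.
  move=> s; rewrite in_itv/= => sT.
  by rewrite /F /Phi (coefB_extE sT) /c -/A -/B; ring.
apply: (derive_within_itv T_gt0 tT FE).
rewrite /d -mulNr; apply: is_derive_lincomb.
  exact: is_derive_coefA.
exact: is_derive_coefB_ext.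
Qed.

Lemma is_derive_Phi_x (t x y u m : R) :
  is_derive x 1 (fun s => F t s y u m) (w * m).
Proof.
(* Phi is affine in each of x, y, u; its value at 0 serves as the intercept. *)
have -> : (fun s => F t s y u m) = (fun s => (w * m) * s + F t 0 y u m).
  by apply/funext => s; rewrite /F /Phi; ring.
exact: is_derive_affine.
Qed.

Lemma is_derive_Phi_y (t x y u m : R) :
  is_derive y 1 (fun s => F t x s u m) (A t * m).
Proof.
have -> : (fun s => F t x s u m) = (fun s => (A t * m) * s + F t x 0 u m).
  by apply/funext => s; rewrite /F /Phi /A; ring.
exact: is_derive_affine.
Qed.

Lemma is_derive_Phi_u (t x y u m : R) :
  is_derive u 1 (fun s => F t x y s m) (w' * m).
Proof.
have -> : (fun s => F t x y s m) = (fun s => (w' * m) * s + F t x y 0 m).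
  by apply/funext => s; rewrite /F /Phi; ring.
exact: is_derive_affine.
Qed.

Lemma is_derive_Phi_m (t x y u m : R) : 0 <= t <= T -> 0 < m ->
  is_derive m 1 (fun s => F t x y u s)
    (w * x + w' * u + A t * y + B t - ln m - 1).
Proof.
move=> tT m0.
have -> : (fun s => F t x y u s) =
    (fun s => (w * x + w' * u + A t * y + B t) * s - s * ln s).
  by apply/funext => s; rewrite /F /Phi (coefB_extE tT) -/A -/B; ring.
exact: is_derive_affine_entropy.
Qed.

Lemma partial_x_Phi (t x y u m : R) : partial_x F t x y u m = w * m.
Proof.
by rewrite /partial_x derive1E; have [_ ->] := is_derive_Phi_x t x y u m.
Qed.

Lemma partial_y_Phi (t x y u m : R) : partial_y F t x y u m = A t * m.
Proof.
by rewrite /partial_y derive1E; have [_ ->] := is_derive_Phi_y t x y u m.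
Qed.

Lemma partial_u_Phi (t x y u m : R) : partial_u F t x y u m = w' * m.
Proof.
by rewrite /partial_u derive1E; have [_ ->] := is_derive_Phi_u t x y u m.
Qed.

Lemma partial_m_Phi (t x y u m : R) : 0 <= t <= T -> 0 < m ->
  partial_m F t x y u m = w * x + w' * u + A t * y + B t - ln m - 1.
Proof.
move=> tT m0; rewrite /partial_m derive1E.
by have [_ ->] := is_derive_Phi_m x y u tT m0.
Qed.

Lemma C1_Phi : C1_on_domain T F.
Proof.
have projs (p : R * R * R * R * R) :
    [/\ {for p, continuous (fun p : R * R * R * R * R => p.1.1.1.1)},
        {for p, continuous (fun p : R * R * R * R * R => p.1.1.1.2)},
        {for p, continuous (fun p : R * R * R * R * R => p.1.1.2)},
        {for p, continuous (fun p : R * R * R * R * R => p.1.2)}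
      & {for p, continuous (fun p : R * R * R * R * R => p.2)}].
  split.
  - apply: (continuous_fst_comp (f := fun r : R * R * R * R => r.1.1.1)).
    apply: (continuous_fst_comp (f := fun r : R * R * R => r.1.1)).
    by apply: (continuous_fst_comp (f := fun r : R * R => r.1)); exact: cvg_fst.
  - apply: (continuous_fst_comp (f := fun r : R * R * R * R => r.1.1.2)).
    apply: (continuous_fst_comp (f := fun r : R * R * R => r.1.2)).
    by apply: (continuous_fst_comp (f := fun r : R * R => r.2)); exact: cvg_snd.
  - apply: (continuous_fst_comp (f := fun r : R * R * R * R => r.1.2)).
    apply: (continuous_fst_comp (f := fun r : R * R * R => r.2)).
    exact: cvg_snd.
  - apply: (continuous_fst_comp (f := fun r : R * R * R * R => r.2)).
    exact: cvg_snd.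
  - exact: cvg_snd.
have contA (p : R * R * R * R * R) :
    {for p, continuous (fun p : R * R * R * R * R => A p.1.1.1.1)}.
  have [ct _ _ _ _] := projs p.
  exact: (continuous_comp ct (@continuous_coefA _)).
have contB p : domain T p ->
    {for p, continuous (fun p : R * R * R * R * R => B p.1.1.1.1)}.
  have [ct _ _ _ _] := projs p.
  case: p ct => [[[[t x] y] u] m] ct [tT _ _ _ _].
  exact: (continuous_comp ct (continuous_coefB_ext tT)).
have contln p : domain T p ->
    {for p, continuous (fun p : R * R * R * R * R => ln p.2)}.
  have [_ _ _ _ cm] := projs p.
  case: p cm => [[[[t x] y] u] m] cm [_ _ _ _ m0].
  exact: (continuous_comp cm (continuous_ln m0)).
split.
- apply: (within_eq_continuous
    (g := fun p : R * R * R * R * R =>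
          w * p.1.1.1.2 * p.2 + w' * p.1.2 * p.2 - p.2 * ln p.2
          + A p.1.1.1.1 * p.2 * p.1.1.2 + B p.1.1.1.1 * p.2)).
    move=> [[[[t x] y] u] m] [tT _ _ _ _] /=.
    by rewrite /F /Phi coefB_extE.
  move=> p Dp; have [ct cx cy cu cm] := projs p.
  have cA := contA p; have cB := contB p Dp; have cln := contln p Dp.
  rewrite /continuous_at in ct cx cy cu cm cA cB cln *.
  apply: cvgD; [apply: cvgD; [apply: cvgB; [apply: cvgD|]|]|].
  + by apply: cvgM => //; apply: cvgM => //; exact: cvg_cst.
  + by apply: cvgM => //; apply: cvgM => //; exact: cvg_cst.
  + exact: cvgM.
  + by apply: cvgM => //; exact: cvgM.
  + exact: cvgM.
- move=> t x y u m [tT x0 y0 u0 m0]; split.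
  + by have [] := is_derive_Phi_t x y u m tT.
  + by have [] := is_derive_Phi_x t x y u m.
  + by have [] := is_derive_Phi_y t x y u m.
  + by have [] := is_derive_Phi_u t x y u m.
  + by have [] := is_derive_Phi_m x y u tT m0.
- split.
  + apply: (within_eq_continuous
      (g := fun p : R * R * R * R * R =>
             - what * expR (lambda * (p.1.1.1.1 - T)) * (p.2 * p.1.1.2)
             - (q * what + jump p.1.1.1.1) * p.2)).
      move=> [[[[t x] y] u] m] [tT _ _ _ _] /=.
      by have [_ ->] := is_derive_Phi_t x y u m tT.
    move=> p Dp; have [ct cx cy cu cm] := projs p.
    have cJ := continuous_comp ct (@continuous_jump _).
    rewrite /continuous_at in ct cx cy cu cm cJ *.
    apply: cvgB; apply: cvgM => //.
    * apply: cvgM; first exact: cvg_cst.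
      apply: continuous_comp; last exact: continuous_expR.
      by apply: cvgM; [exact: cvg_cst|apply: cvgB => //; exact: cvg_cst].
    * exact: cvgM.
    * by apply: cvgD => //; exact: cvg_cst.
  + apply: (within_eq_continuous (g := fun p : R * R * R * R * R => w * p.2)).
      by move=> [[[[t x] y] u] m] _; exact: partial_x_Phi.
    move=> p _; have [_ _ _ _ cm] := projs p.
    by apply: cvgM => //; exact: cvg_cst.
  + apply: (within_eq_continuous
      (g := fun p : R * R * R * R * R => A p.1.1.1.1 * p.2)).
      by move=> [[[[t x] y] u] m] _; exact: partial_y_Phi.
    move=> p _; have [_ _ _ _ cm] := projs p.
    by apply: cvgM => //; exact: contA.
  + apply: (within_eq_continuous (g := fun p : R * R * R * R * R => w' * p.2)).
      by move=> [[[[t x] y] u] m] _; exact: partial_u_Phi.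
    move=> p _; have [_ _ _ _ cm] := projs p.
    by apply: cvgM => //; exact: cvg_cst.
  + apply: (within_eq_continuous
      (g := fun p : R * R * R * R * R => w * p.1.1.1.2 + w' * p.1.2
        + A p.1.1.1.1 * p.1.1.2 + B p.1.1.1.1 - ln p.2 - 1)).
      by move=> [[[[t x] y] u] m] [tT _ _ _ m0]; exact: partial_m_Phi.
    move=> p Dp; have [ct cx cy cu cm] := projs p.
    have cA := contA p; have cB := contB p Dp; have cln := contln p Dp.
    rewrite /continuous_at in ct cx cy cu cm cA cB cln *.
    apply: cvgB; last exact: cvg_cst.
    apply: cvgB => //; apply: cvgD => //; apply: cvgD; last exact: cvgM.
    by apply: cvgD; apply: cvgM => //; exact: cvg_cst.
Qed.

(** * The inner supremum over strategies *)

Section isaacs.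
Context (n t x y u m : R) (n_gt1 : 1 < n).
Context (tT : 0 <= t <= T) (m_gt0 : 0 < m).

(** Since [ln (m * s) = ln m + ln s], the part of Phi linear in m and the [ln m] terms cancel
    against the compensator, leaving only the shift of y and the entropy of [s = 1 + theta z]. *)
Lemma jump_term (theta : R -> R) (z : R) : -1 < theta z ->
  F t x (y + z) u (m * (1 + theta z)) - F t x y u m
    - theta z * m * partial_m F t x y u m =
  m * ((1 + theta z) * (A t * z) - (1 + theta z) * ln (1 + theta z) + theta z).
Proof.
move=> th; rewrite partial_m_Phi// /F /Phi coefB_extE// -/A -/B lnM ?posrE//.
  by ring.
lra.
Qed.

Lemma generator_Phi (g : R) (theta : R -> R) : strategies theta ->
  generator T lambda q n v F g theta t x y u m =
  ((m * ((y + q) * (cost n w w' g - what) - jump t))%:E +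
   \int[v]_(z in `]0%R, +oo[) (m * ((1 + theta z) * (A t * z)
      - (1 + theta z) * ln (1 + theta z) + theta z))%:E)%E.
Proof.
move=> [_ th]; rewrite /generator; congr (_%:E + _)%E.
  have [_ ->] := is_derive_Phi_t x y u m tT.
  (* By the definition of A, [what * expR (lambda * (t - T))] equals [what - lambda * A t], so the
     [lambda * y * A t * m] terms cancel and [y + q] factors out of the rest. *)
  rewrite partial_x_Phi partial_u_Phi partial_y_Phi /cost /A /coefA.
  field.
  have n0 : n != 0 by rewrite gt_eqF // (lt_trans ltr01).
  by rewrite n0 gt_eqF.
apply: eq_integral => z; rewrite inE/= in_itv/= andbT => z0.
by rewrite jump_term// th.
Qed.

Lemma integral_jump :
  (\int[v]_(z in `]0%R, +oo[) (m * (expR (A t * z) - 1))%:E =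
   (m * jump t)%:E)%E.
Proof.
under eq_integral do rewrite EFinM.
rewrite integralZl//; last exact: intA.
rewrite /jump clampE// /Rintegral EFinM fineK//.
by apply: integrable_fin_num => //; exact: intA.
Qed.

Lemma sup_generator_Phi (g : R) :
  ereal_sup [set generator T lambda q n v F g theta t x y u m
            | theta in @strategies R] =
  (m * ((y + q) * (cost n w w' g - what)))%:E.
Proof.
(* Adding back the [m * jump t] that B' removed reduces both inequalities to comparing jump
   integrals. *)
have valE : (m * ((y + q) * (cost n w w' g - what)))%:E =
    ((m * ((y + q) * (cost n w w' g - what) - jump t))%:E + (m * jump t)%:E)%E.
  by rewrite -EFinD; congr (_%:E); ring.
have mexp : measurable_fun (`]0, +oo[ : set (measurableTypeR R))
    (fun z : measurableTypeR R => expR (A t * z) - 1 : measurableTypeR R).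
  by have /measurable_int/measurable_EFinP := intA tT.
apply/le_anti/andP; split.
- apply: ge_ereal_sup => _ [theta sth <-].
  rewrite generator_Phi// valE leeD2l// -integral_jump.
  have [mth th] := sth.
  apply: le_integral_measurable => //.
  + apply/measurable_EFinP; apply: measurable_funM => //.
    have m1 : measurable_fun (`]0, +oo[ : set (measurableTypeR R))
        (fun z => 1 + theta z : measurableTypeR R) by exact: measurable_funD.
    apply: measurable_funD => //; apply: measurable_funB.
      by apply: measurable_funM => //; exact: measurable_funM.
    by apply: measurable_funM => //; exact: measurableT_comp.
  + by apply/measurable_EFinP; exact: measurable_funM.
  + move=> z /=; rewrite in_itv/= andbT => z0; rewrite lee_fin ler_pM2l//.
    have := @entropy_le R (A t * z) (1 + theta z).
    have := th z z0 => thz /(_ ltac:(lra)); lra.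
(* The equality case [s = expR a] of [entropy_le]; it is admissible because the exponential is
   positive. *)
- pose theta (z : R) := expR (A t * z) - 1.
  have sth : strategies theta.
    by split => // z _; rewrite ltrBrDr addNr expR_gt0.
  apply: ereal_sup_ubound; exists theta => //.
  rewrite generator_Phi// valE -integral_jump; congr (_ + _)%E.
  apply: eq_integral => z _; congr (_%:E); congr (_ * _).
  by rewrite /theta subrKC expRK; ring.
Qed.

End isaacs.
End coefficients.

(** * The outer infimum and the terminal condition *)

Unset Implicit Arguments.
Set Strict Implicit.

Theorem proposition1 (R : realType) (T lambda q n w w' : R)
    (T_gt0 : 0 < T) (lambda_gt0 : 0 < lambda) (q_ge0 : 0 <= q) (n_gt1 : 1 < n)
    (w_gt0 : 0 < w) (w'_gt0 : 0 < w')
    (omega : set R) (omega01 : omega `<=` `[0, 1])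
    (omega_neq0 : omega !=set0) (omega_compact : compact omega)
    (v : {measure set (measurableTypeR R) -> \bar R})
    (v_levy : (\int[v]_(z in `]0%R, +oo[) (Num.min 1 z)%:E < +oo)%E)
    (gbar : R) (gbar_argmin : argmin omega (cost n w w') gbar) :
  let what := cost n w w' gbar in
  (forall t : R, 0 <= t <= T ->
     v.-integrable `]0, +oo[
       (fun z => (expR (coefA T lambda what t * z) - 1)%:E)) ->
  let F := Phi T lambda q w w' what v in
  C1_on_domain T F /\
  (forall t x y u m : R, 0 <= t < T -> 0 < x -> 0 < y -> 0 < u -> 0 < m ->
     HJBI_operator T lambda q n omega v F t x y u m = 0%E) /\
  (forall x y u m : R, 0 < x -> 0 < y -> 0 < u -> 0 < m ->
     F T x y u m = m * (w * x + w' * u - ln m)).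
Proof.
move=> what intA F.
have [gbar_omega gbar_min] := gbar_argmin.
(* Here [gbar] in [0, 1] gives [1 - gbar >= 0]; the sign makes A nonnegative, as the domination
   argument requires. *)
have what_ge0 : 0 <= what.
  have /omega01 := gbar_omega; rewrite /= in_itv/= => /andP[g0 g1].
  rewrite /what /cost addr_ge0// mulr_ge0 ?mulr_ge0 ?subr_ge0 ?invr_ge0
    ?powR_ge0//; lra.
split; first exact: C1_Phi.
split=> [t x y u m /andP[t0 tT] x0 y0 u0 m0|x y u m x0 y0 u0 m0].
- have tT' : 0 <= t <= T by rewrite t0 ltW.
  have supE g : ereal_sup [set generator T lambda q n v F g theta t x y u m
      | theta in @strategies R] = (m * ((y + q) * (cost n w w' g - what)))%:E.
    exact: sup_generator_Phi.
  (* The value 0 is reached at [gbar]; for other controls minimality of [gbar] and [y + q >= 0] give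
     a nonnegative supremum. *)
  rewrite /HJBI_operator; apply/le_anti/andP; split.
    apply: ereal_inf_lbound; exists gbar => //.
    by rewrite supE subrr mulr0 mulr0.
  apply: le_ereal_inf_tmp => _ [g /gbar_min g_min <-].
  rewrite supE lee_fin; apply: mulr_ge0; first exact: ltW.
  by apply: mulr_ge0; [rewrite addr_ge0// ltW|rewrite subr_ge0].
(* At time T, B integrates over a single point and A vanishes because [expR 0 = 1]. *)
- rewrite /F /Phi /coefA /Defs.coefB set_itv1 Rintegral_set1.
  by rewrite subrr mulr0 expR0 subrr; ring.
Qed.
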